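(* For any $\omega\in\mathbb{T}$, the operator $\mathcal{T}_\omega$ restricted to the set $\mathcal{D}_0(\mathcal{T})$ is isomorphically conjugate to $\mathcal{R}_\delta$ (through the natural identification of one-dimensional maps with maps not depending on $\theta$). Concretely, any fixed point of $\mathcal{R}_\delta$ extends (by this inclusion) to a fixed point of $\mathcal{T}_\omega$.
   Context: $\mathbb{T}=\mathbb{R}/\mathbb{Z}$; $\delta>0$ is a fixed small number; $I_\delta=[-1-\delta,1+\delta]$; $r\ge1$ is fixed. $\mathcal{M}_\delta$ is the set of continuously differentiable (here of class $C^r$) even maps $\psi:I_\delta\to I_\delta$ with $\psi(0)=1$ and $x\psi'(x)<0$ for $x\neq0$. With $a=\psi(1)$, $a'=(1+\delta)a$, $b'=\psi(a')$, the set $\mathcal{D}(\mathcal{R}_\delta)$ consists of those $\psi\in\mathcal{M}_\delta$ with $a<0$, $1>b'>-a'$ and $\psi(b')<-a'$. The operator $\mathcal{R}_\delta:\mathcal{D}(\mathcal{R}_\delta)\to\mathcal{M}_\delta$ is $\mathcal{R}_\delta(\psi)(x)=\frac1a\psi(\psi(ax))$, $a=\psi(1)$. For $f:\mathbb{T}\times I_\delta\to I_\delta$, $p_0(f)(x)=\int_0^1f(\theta,x)\,d\theta$. $\mathcal{X}=\{f\in C^r(\mathbb{T}\times I_\delta,I_\delta): p_0(f)\in\mathcal{M}_\delta\}$ and $\mathcal{X}_0=\{f\in\mathcal{X}:p_0(f)=f\}$, which is an isomorphic copy of $\mathcal{M}_\delta$ (functions independent of $\theta$). For $g\in\mathcal{X}$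 and $\omega\in\mathbb{T}$, $[\mathcal{T}_\omega(g)](\theta,x)=\frac1{\hat a}g(\theta+\omega,g(\theta,\hat ax))$ with $\hat a=\int_0^1g(\theta,1)\,d\theta$, with domain $\mathcal{D}(\mathcal{T})=\{g\in\mathcal{X}:\mathcal{T}_\omega(g)\in\mathcal{X}\}$. $\mathcal{D}_0(\mathcal{T})\subset\mathcal{X}_0$ is the set of functions in $\mathcal{X}_0$ corresponding to functions of $\mathcal{D}(\mathcal{R}_\delta)$. *)

(* Defs.v *)
From mathcomp Require Import all_boot all_order all_algebra.
From mathcomp Require Import generic_quotient ring_quotient.
From mathcomp Require Import all_classical all_reals all_analysis.

Set Implicit Arguments.
Unset Strict Implicit.
Unset Printing Implicit Defensive.

Import Order.TTheory GRing.Theory Num.Theory numFieldNormedType.Exports.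

Local Open Scope classical_set_scope.
Local Open Scope ring_scope.
Local Open Scope quotient_scope.

Section Renormalization.
Variable R : realType.

(* [Num.int_num_subdef] is the predicate underlying the qualifier [Num.int]. *)
Definition Zsub : zmodClosed R :=
  GRing.ZmodClosed.clone R (@Num.int_num_subdef R) _.

(* The quotient group R / Z. *)
Definition torus := {ideal_quot Zsub}.

Definition Iitv (delta : R) : interval R := `[-1 - delta, 1 + delta].

Definition Idelta (delta : R) : Type := {x : R | x \in Iitv delta}.

(* A map I_delta -> I_delta is an [f : Idelta delta -> R] whose values lie in
   I_delta, see [into1].  To evaluate it at a real number, [ext] extends it
   by the junk value 0 outside I_delta. *)
Definition ext (delta : R) (f : Idelta delta -> R) (x : R) : R :=
  if insub x is Some u then f u else 0.

(* Lift to R x R, 1-periodic in the first variable. *)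
Definition lift (delta : R) (f : torus -> Idelta delta -> R) (t x : R) : R :=
  ext (f (\pi_torus t)) x.

Section Smoothness.
Variable delta : R.
Local Notation I := [set` Iitv delta].

(* The derivative along I_delta: it is one-sided at the two end points. *)
Definition dquot (f : R -> R) (x y : R) : R := (f y - f x) / (y - x).

Definition derivableI (f : R -> R) (x : R) : Prop :=
  cvg (dquot f x @ within I x^').

Definition derivI (f : R -> R) (x : R) : R := lim (dquot f x @ within I x^').

Definition Cr1 (r : nat) (f : Idelta delta -> R) : Prop :=
  forall k : nat, (k <= r)%N ->
    {within I, continuous (iter k derivI (ext f))} /\
    ((k < r)%N -> forall x, x \in Iitv delta ->
       derivableI (iter k derivI (ext f)) x).

Definition Cr_norm1 (r : nat) (f : Idelta delta -> R) : \bar R :=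
  ereal_sup [set y | exists (k : nat) (x : R),
    [/\ (k <= r)%N, x \in Iitv delta & y = `|iter k derivI (ext f) x|%:E]].

Definition dtheta (F : R -> R -> R) (t x : R) : R := derive1 (F ^~ x) t.

Definition dx (F : R -> R -> R) (t x : R) : R := derivI (F t) x.

(* Iterated mixed partial derivative along a word of differentiations:
   the letter true is the derivative in theta, false the one in x. *)
Definition mixed (w : seq bool) (F : R -> R -> R) : R -> R -> R :=
  foldr (fun b G => if b then dtheta G else dx G) F w.

(* The function f is of class C^r on torus x I_delta: all the mixed partial
   derivatives of order at most r of its lift exist and are continuous. *)
Definition Cr2 (r : nat) (f : torus -> Idelta delta -> R) : Prop :=
  forall w : seq bool, (size w <= r)%N ->
    {within [set: R] `*` I,
       continuous (fun p : R * R => mixed w (lift f) p.1 p.2)} /\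
    ((size w < r)%N -> forall t x, x \in Iitv delta ->
       derivable (mixed w (lift f) ^~ x) t 1 /\
       derivableI (mixed w (lift f) t) x).

Definition Cr_norm2 (r : nat) (f : torus -> Idelta delta -> R) : \bar R :=
  ereal_sup [set y | exists (w : seq bool) (t x : R),
    [/\ (size w <= r)%N, x \in Iitv delta &
        y = `|mixed w (lift f) t x|%:E]].

End Smoothness.

Definition into1 (delta : R) (f : Idelta delta -> R) : Prop :=
  forall x, f x \in Iitv delta.

Definition into2 (delta : R) (f : torus -> Idelta delta -> R) : Prop :=
  forall t x, f t x \in Iitv delta.

Section Spaces.
Variables (delta : R) (r : nat).

Definition Mdelta : set (Idelta delta -> R) := [set psi |
  [/\ into1 psi, Cr1 r psi,
      forall x, x \in Iitv delta -> ext psi (- x) = ext psi x,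
      ext psi 0 = 1 &
      forall x, x \in Iitv delta -> x != 0 ->
        x * derivI delta (ext psi) x < 0]].

(* For psi in M_delta, the conditions 1 > b' > - a' and a < 0 force
   a' and b' to lie in I_delta, so that the junk values of [ext] are not used;
   they also give a * x in I_delta for all x in I_delta. *)
Definition DRdelta : set (Idelta delta -> R) := [set psi |
  Mdelta psi /\
  let a := ext psi 1 in
  let a' := (1 + delta) * a in
  let b' := ext psi a' in
  [/\ a < 0, - a' < b', b' < 1 & ext psi b' < - a']].

Definition Rdelta (psi : Idelta delta -> R) : Idelta delta -> R :=
  fun x => let a := ext psi 1 in a^-1 * ext psi (ext psi (a * val x)).

Definition p0 (f : torus -> Idelta delta -> R) : Idelta delta -> R :=
  fun x => (\int[@lebesgue_measure R]_(t in `[0, 1]) f (\pi_torus t) x)%R.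

Definition Xspace : set (torus -> Idelta delta -> R) := [set f |
  [/\ into2 f, Cr2 r f & Mdelta (p0 f)]].

Definition Xspace0 : set (torus -> Idelta delta -> R) := [set f |
  Xspace f /\ (fun _ => p0 f) = f].

Definition ahat (g : torus -> Idelta delta -> R) : R :=
  (\int[@lebesgue_measure R]_(t in `[0, 1]) ext (g (\pi_torus t)) 1)%R.

Definition Tomega (omega : torus) (g : torus -> Idelta delta -> R) :
    torus -> Idelta delta -> R :=
  fun t x => (ahat g)^-1 * ext (g (t + omega)) (ext (g t) (ahat g * val x)).

(* The second and third conditions say that the formula for T_omega(g) is meaningful
   on the whole of torus x I_delta. *)
Definition DT (omega : torus) : set (torus -> Idelta delta -> R) := [set g |
  [/\ Xspace g, ahat g != 0,
      forall x, x \in Iitv delta -> ahat g * x \in Iitv delta &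
      Xspace (Tomega omega g)]].

(* The identification of maps of I_delta with maps independent of theta. *)
Definition theta_incl (psi : Idelta delta -> R) : torus -> Idelta delta -> R :=
  fun _ => psi.

Definition DT0 : set (torus -> Idelta delta -> R) := theta_incl @` DRdelta.

(* h is an isomorphism from A onto B for the C^r structures. *)
Definition Cr_isomorphism (A : set (Idelta delta -> R))
    (B : set (torus -> Idelta delta -> R))
    (h : (Idelta delta -> R) -> torus -> Idelta delta -> R) : Prop :=
  set_bij A B h /\
  forall phi psi, A phi -> A psi ->
    Cr_norm2 r (fun t x => h phi t x - h psi t x) =
    Cr_norm1 r (fun x => phi x - psi x).

End Spaces.

End Renormalization.

Arguments Mdelta {R} delta r _.
Arguments DRdelta {R} delta r _.
Arguments Xspace {R} delta r _.
Arguments Xspace0 {R} delta r _.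
Arguments DT {R} delta r omega _.
Arguments DT0 {R} delta r _.
Arguments theta_incl {R} delta psi _ _.
Arguments Rdelta {R} delta psi _.
Arguments Tomega {R} delta omega g _ _.

(* h, mapping A onto B and A' onto B', conjugates F : A' -> A
   with G : B' -> B. *)
Definition conjugates (U V : Type) (A' A : set U) (B' B : set V)
    (h : U -> V) (F : U -> U) (G : V -> V) : Prop :=
  [/\ set_bij A' B' h, set_bij A B h, set_fun A' A F, set_fun B' B G &
      forall u, A' u -> G (h u) = h (F u)].

(* Main.v *)
Require Import Defs.
From mathcomp Require Import all_boot all_order all_algebra.
From mathcomp Require Import all_classical all_reals all_analysis.
From mathcomp Require Import ring lra.

Set Implicit Arguments.
Unset Strict Implicit.
Unset Printing Implicit Defensive.

Import Order.TTheory GRing.Theory Num.Theory numFieldNormedType.Exports.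

Local Open Scope classical_set_scope.
Local Open Scope ring_scope.

(** On a function that does not depend on theta, the mean over the circle is
    the function itself, so the factor of [Tomega] is [psi 1] and the rotation
    by [omega] has no effect: [Tomega] applied to [theta_incl psi] is literally
    [theta_incl] of [Rdelta psi] (lemma [Tomega_theta_incl]).  Two things
    remain.

    The first is that [Rdelta] really maps its domain into [Mdelta]
    (lemma [Rdelta_Mdelta]).  Write [a = psi 1 < 0], [a' = (1 + delta) * a] and
    [b' = psi a'].  A map of [Mdelta] is even and, by the sign of its
    derivative and the mean value theorem, nonincreasing in the absolute value
    of its argument.  Since [a * x] has absolute value at most [- a'] when [x]
    is in the interval, [psi (a * x)] lies in [[b', 1]], and [b' > 0]; applying
    [psi] again gives values between [psi 1 = a] and [psi b' < - a'].  Dividing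
    by [a] brings them back into the interval.  The derivative of [Rdelta psi]
    at [x] is [psi' (psi (a * x)) * psi' (a * x)], whose first factor is
    negative because [psi (a * x) > 0], and whose second factor has the sign of
    [x] because [a < 0].  Class C^r is preserved because C^r functions are
    stable under products and composition; with derivatives that are one-sided
    at the end points, this is obtained from slope functions in the manner of
    Caratheodory, by induction on the order of differentiability.

    The second is that [theta_incl] identifies the C^r structures
    (lemmas [Cr2_theta_incl] and [Cr_norm2_theta_incl]).  A mixed partial
    derivative of a function of [x] alone vanishes as soon as theta occurs in
    it, and is otherwise an iterated derivative in [x]; hence both the
    regularity and the C^r distance are those of the one-variable map. *)

(** * Calculus on the interval, with one-sided derivatives at the end points *)

Section Calculus.
Variables (R : realType) (delta : R).
Local Notation I := [set` Iitv delta].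
Implicit Types (f g q : R -> R) (x l : R).

Lemma in_Iitv x : (x \in Iitv delta) = (`|x| <= 1 + delta).
Proof. by rewrite /Iitv in_itv /= ler_norml opprD. Qed.

Lemma within_dnbhsE x (A : set R) :
  within I x^' A <-> nbhs x [set y | y != x -> I y -> A y].
Proof. by []. Qed.

Definition contI f : Prop := forall x, I x -> f @ within I (nbhs x) --> f x.

Definition has_derivI f x l : Prop := dquot f x @ within I x^' --> l.

(** Caratheodory's form of differentiability: [q] is a slope function of [f]
    at [x] that is continuous at [x], and then [q x] is the derivative.  There
    is no quotient, so that products and compositions are handled without
    separating the case of equal arguments. *)
Definition slopeI f x q : Prop :=
  (forall y, I y -> f y - f x = q y * (y - x)) /\
  q @ within I (nbhs x) --> q x.

Lemma slopeI_deriv f x q : slopeI f x q -> has_derivI f x (q x).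
Proof.
move=> [fq cq] A Aqx; have : nbhs x [set y | I y -> A (q y)] := cq A Aqx.
apply: filterS => y /= Aqy yx Iy.
by rewrite /dquot /= fq// mulfK ?subr_eq0//; apply: Aqy.
Qed.

Lemma has_derivI_slope f x l : has_derivI f x l ->
  exists2 q, slopeI f x q & q x = l.
Proof.
move=> fl; exists (fun y => if y == x then l else dquot f x y); last first.
  by rewrite eqxx.
split=> [y Iy|].
  have [->|yx] := eqVneq y x; first by rewrite !subrr mulr0.
  by rewrite /dquot mulfVK// subr_eq0.
rewrite eqxx => A Al.
have : nbhs x [set y | y != x -> I y -> A (dquot f x y)] := fl A Al.
apply: filterS => y /= Ay Iy; case: eqVneq => yx; last exact: Ay.
exact: nbhs_singleton.
Qed.

Lemma eq_contI f g : {in Iitv delta, f =1 g} -> contI f -> contI g.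
Proof.
move=> fg cf x Ix; rewrite -fg//; apply: cvg_trans (cf x Ix).
by apply: near_eq_cvg; near do apply: fg; exact: withinT.
Unshelve. all: by end_near.
Qed.

Lemma eq_has_derivI f g x l : I x -> {in Iitv delta, f =1 g} ->
  has_derivI f x l -> has_derivI g x l.
Proof.
move=> Ix fg; apply: cvg_trans.
apply: near_eq_cvg; near=> y; rewrite /dquot !fg//.
by near: y; exact: withinT.
Unshelve. all: by end_near.
Qed.

Lemma eq_derivI f g : {in Iitv delta, f =1 g} ->
  {in Iitv delta, derivI delta f =1 derivI delta g}.
Proof.
move=> fg x Ix; rewrite /derivI; congr (lim _).
rewrite eqEsubset; split;
  apply: (@fmap_within_eq R _ R x^' _ _ _) => y /set_mem/= Iy;
  by rewrite /dquot !fg.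
Qed.

Lemma has_derivI_cst (c x : R) : has_derivI (cst c) x 0.
Proof.
apply: (@slopeI_deriv (cst c) x (cst 0)); split; last exact: cvg_cst.
by move=> y _; rewrite /= subrr mul0r.
Qed.

Lemma has_derivI_id x : has_derivI id x 1.
Proof.
apply: (@slopeI_deriv id x (cst 1)); split; last exact: cvg_cst.
by move=> y _; rewrite /= mul1r.
Qed.

Lemma has_derivID f g x l m : has_derivI f x l -> has_derivI g x m ->
  has_derivI (f \+ g) x (l + m).
Proof.
move=> /has_derivI_slope[p [fp cp] <-] /has_derivI_slope[q [gq cq] <-].
apply: (@slopeI_deriv _ _ (p \+ q)); split; last exact: cvgD.
by move=> y Iy; rewrite /= mulrDl -fp// -gq//; ring.
Qed.

Lemma has_derivIM f g x l m : I x -> contI f ->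
  has_derivI f x l -> has_derivI g x m ->
  has_derivI (f \* g) x (f x * m + l * g x).
Proof.
move=> Ix cf /has_derivI_slope[p [fp cp] <-] /has_derivI_slope[q [gq cq] <-].
apply: (@slopeI_deriv _ _ (fun y => f y * q y + p y * g x)); split.
  by move=> y Iy; rewrite /= mulrDl -mulrA -gq// mulrAC -fp//; ring.
by apply: cvgD; [apply: cvgM => //; exact: cf|exact: cvgMl].
Qed.

Lemma cvg_within_into g x : I x -> contI g -> (forall y, I y -> I (g y)) ->
  g @ within I (nbhs x) --> within I (nbhs (g x)).
Proof.
move=> Ix cg Ig A Agx.
have : nbhs x [set y | I y -> I (g y) -> A (g y)] := cg x Ix _ Agx.
by apply: filterS => y /= Ay Iy; apply: Ay => //; exact: Ig.
Qed.

Lemma has_derivI_comp f g x l m : I x -> contI g ->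
  (forall y, I y -> I (g y)) ->
  has_derivI f (g x) l -> has_derivI g x m -> has_derivI (f \o g) x (l * m).
Proof.
move=> Ix cg Ig /has_derivI_slope[p [fp cp] <-].
move=> /has_derivI_slope[q [gq cq] <-].
apply: (@slopeI_deriv _ _ (fun y => p (g y) * q y)); split.
  by move=> y Iy /=; rewrite -mulrA -gq// -fp//; exact: Ig.
apply: cvgM => //; apply: cvg_comp cp; exact: cvg_within_into.
Qed.

(** Class C^k by recursion on [k].  Here the derivative is any function that
    is the derivative on the interval, whatever its values outside, so that
    the stability lemmas below can exhibit it by the usual formulas. *)
Fixpoint CrI k f : Prop :=
  if k is k'.+1 then
    contI f /\ exists2 f', (forall x, I x -> has_derivI f x (f' x)) & CrI k' f'
  else contI f.

Lemma CrI_cont k f : CrI k f -> contI f.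
Proof. by case: k => [|k] // []. Qed.

Lemma CrI_pred k f : CrI k.+1 f -> CrI k f.
Proof.
elim: k f => [|k IH] f [cf [f' df sf]] //.
by split => //; exists f' => //; exact: IH.
Qed.

Lemma eq_CrI k f g : {in Iitv delta, f =1 g} -> CrI k f -> CrI k g.
Proof.
move=> fg; case: k => [|k]; first exact: eq_contI.
move=> [cf [f' df sf]]; split; first exact: eq_contI cf.
by exists f' => // x Ix; apply: (eq_has_derivI Ix fg); exact: df.
Qed.

Lemma CrI_cst k c : CrI k (cst c).
Proof.
elim: k c => [|k IH] c; first by move=> x _; exact: cvg_cst.
split; first by move=> x _; exact: cvg_cst.
by exists (cst 0) => // x _; exact: has_derivI_cst.
Qed.

Lemma CrI_id k : CrI k id.
Proof.
have cid : contI id by move=> x Ix; exact: cvg_within.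
case: k => [|k] //; split=> //; exists (cst 1); last exact: CrI_cst.
by move=> x _; exact: has_derivI_id.
Qed.

Lemma CrID k f g : CrI k f -> CrI k g -> CrI k (f \+ g).
Proof.
have cD f1 g1 : contI f1 -> contI g1 -> contI (f1 \+ g1).
  by move=> cf cg x Ix; apply: cvgD; [exact: cf|exact: cg].
elim: k f g => [|k IH] f g; first exact: cD.
move=> [cf [f' df sf]] [cg [g' dg sg]]; split; first exact: cD.
exists (f' \+ g'); last exact: IH.
by move=> x Ix; apply: has_derivID; [exact: df|exact: dg].
Qed.

Lemma CrIM k f g : CrI k f -> CrI k g -> CrI k (f \* g).
Proof.
have cM f1 g1 : contI f1 -> contI g1 -> contI (f1 \* g1).
  by move=> cf cg x Ix; apply: cvgM; [exact: cf|exact: cg].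
elim: k f g => [|k IH] f g; first exact: cM.
move=> sf sg; have [sf1 sg1] := (CrI_pred sf, CrI_pred sg).
move: sf sg => [cf [f' df sf']] [cg [g' dg sg']]; split; first exact: cM.
exists ((f \* g') \+ (f' \* g)); last by apply: CrID; apply: IH.
by move=> x Ix; apply: has_derivIM => //; [exact: df|exact: dg].
Qed.

(** By the chain rule the derivative is [(f' \o g) \* g'], where both factors
    are of class C^k by induction; this is where stability under products is
    needed. *)
Lemma CrI_comp k f g : (forall x, I x -> I (g x)) ->
  CrI k f -> CrI k g -> CrI k (f \o g).
Proof.
move=> Ig.
have cC f1 g1 : (forall x, I x -> I (g1 x)) ->
    contI f1 -> contI g1 -> contI (f1 \o g1).
  move=> Ig1 cf cg x Ix; apply: cvg_comp (cf _ (Ig1 _ Ix)).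
  exact: cvg_within_into.
elim: k f => [|k IH] f; first exact: cC.
move=> [cf [f' df sf']] sg; have sg1 := CrI_pred sg.
move: sg => [cg [g' dg sg']]; split; first exact: cC.
exists ((f' \o g) \* g'); last by apply: CrIM => //; exact: IH.
by move=> x Ix; apply: has_derivI_comp => //; [exact/df/Ig|exact: dg].
Qed.

Hypothesis delta_gt0 : 0 < delta.

(** Every point of the interval, an end point included, is a limit of other
    points of the interval; otherwise limits of difference quotients would not
    be unique. *)
Lemma within_dnbhs_proper x : I x -> ProperFilter (within I x^').
Proof.
move=> Ix; split; last exact: within_filter.
move=> /within_dnbhsE/nbhs_ballP; rewrite /= => -[] /= d.
(* [e] is [d] with its type spelled as [R], for the sake of arithmetic. *)
pose e : R := d; rewrite -[d]/e; move: e => {d}e e0 xe.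
move: (Ix); rewrite /= /Iitv in_itv/= => /andP[x1 x2].
pose t : R := Num.min (e / 2) (1 / 2).
have t0 : 0 < t by rewrite lt_min !divr_gt0.
have te : t < e by rewrite gt_min ltr_pdivrMr// ltr_pMr// ltr1n.
have t1 : t <= 1 / 2 by rewrite ge_min lexx orbT.
(* A step of at most 1/2 towards the other half stays in the interval. *)
clearbody t; have [x0|x0] := lerP x 0.
  apply: (xe (x + t)).
  - by rewrite /ball/= opprD addNKr normrN gtr0_norm.
  - by rewrite -subr_eq0 addrC addKr gt_eqF.
  - rewrite /= /Iitv in_itv/=; apply/andP; split;
    by move: x1 x2 t0 t1 x0 delta_gt0; clear; lra.
apply: (xe (x - t)).
- by rewrite /ball/= opprB addrC subrK gtr0_norm.
- by rewrite -subr_eq0 addrC addKr oppr_eq0 gt_eqF.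
- rewrite /= /Iitv in_itv/=; apply/andP; split;
  by move: x1 x2 t0 t1 x0 delta_gt0; clear; lra.
Qed.

Lemma has_derivIE f x l : I x -> has_derivI f x l -> derivI delta f x = l.
Proof.
move=> Ix; have := within_dnbhs_proper Ix => PF.
by apply: cvg_lim.
Qed.

Lemma derivI_cst (c x : R) : I x -> derivI delta (cst c) x = 0.
Proof. by move=> Ix; apply: has_derivIE => //; exact: has_derivI_cst. Qed.

Lemma CrIP r f : CrI r f <->
  forall k : nat, (k <= r)%N ->
    {within I, continuous (iter k (derivI delta) f)} /\
    ((k < r)%N -> forall x, x \in Iitv delta ->
       derivableI delta (iter k (derivI delta) f) x).
Proof.
have cP h : contI h <-> {within I, continuous h}.
  by apply: iff_sym; exact: subspace_continuousP.
elim: r f => [|r IH] f.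
  split=> [sf k|/(_ 0 isT)[/cP//]].
  by rewrite leqn0 => /eqP ->; split => //; exact/cP.
split=> [[cf [f' df sf]] [_|k]|H].
- by split=> [|_ x /df fx]; [exact/cP|exact: (cvgP (f' x))].
- rewrite !ltnS => kr; rewrite iterSr.
  apply: (IH _).1 kr; apply: eq_CrI sf => x Ix.
  by apply/esym/has_derivIE => //; exact: df.
split; first by apply/cP; have [] := H 0 isT.
exists (derivI delta f); first by move=> x Ix; apply: (H 0 isT).2.
by apply/IH => k kr; have := H k.+1 kr; rewrite iterSr !ltnS.
Qed.

Lemma nonincreasing_derivI f f' : contI f ->
  (forall x, I x -> has_derivI f x (f' x)) ->
  (forall x, I x -> 0 < x -> f' x <= 0) ->
  forall x y, 0 <= x -> x <= y -> y <= 1 + delta -> f y <= f x.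
Proof.
move=> cf df nf x y x0 + y1; rewrite le_eqVlt => /predU1P[->//|xy].
have sub z : z \in `[x, y] -> I z.
  rewrite in_itv/= in_Iitv ler_norml => /andP[xz zy].
  by apply/andP; split; move: x0 xz zy y1 delta_gt0; clear; lra.
have [z|/=|c cxy] := @MVT R f f' x y xy.
- rewrite in_itv/= => /andP[xz zy].
  have Iz : I z by apply: sub; rewrite in_itv/= !ltW.
  have nI : nbhs z I.
    have : z \in `]x, y[ by rewrite in_itv/= xz.
    by move=> /near_in_itvoo; apply: filterS => u /subset_itv_oo_cc; exact: sub.
  apply/is_derive1_caratheodory.
  exists (fun u => if u == z then f' z else dquot f z u); split.
  + move=> u; have [->|uz] := eqVneq u z; first by rewrite !subrr mulr0.
    by rewrite /dquot mulfVK// subr_eq0.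
  + rewrite /prop_for /continuous_at eqxx => A Az.
    have : nbhs z [set u | u != z -> I u -> A (dquot f z u)] := df z Iz A Az.
    apply: filterS2 nI => u /= Iu Au; case: eqVneq => uz; last exact: Au.
    exact: nbhs_singleton.
  + by rewrite eqxx.
- apply: (@continuous_subspaceW _ _ _ I) => //.
  by apply/subspace_continuousP.
- move=> e; rewrite -subr_le0 e; apply: mulr_le0_ge0.
    apply: nf; first by apply: sub; exact: subset_itv_oo_cc.
    by move: cxy; rewrite in_itv/= => /andP[xc _]; exact: le_lt_trans xc.
  by rewrite subr_ge0 ltW.
Qed.

End Calculus.

(** * The renormalization operator maps its domain into the space of maps *)

Section OneDim.
Variables (R : realType) (delta : R).
Hypothesis delta_gt0 : 0 < delta.
Local Notation I := [set` Iitv delta].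

Lemma ext_val (f : Idelta delta -> R) (u : Idelta delta) : ext f (val u) = f u.
Proof. by rewrite /ext valK. Qed.

Lemma ext_in (f : Idelta delta -> R) x (Ix : x \in Iitv delta) :
  ext f x = f (exist _ x Ix).
Proof. by rewrite -ext_val. Qed.

Lemma Idelta0 : 0 \in Iitv delta.
Proof. by rewrite in_Iitv normr0 addr_ge0// ltW. Qed.

Lemma Idelta1 : 1 \in Iitv delta.
Proof. by rewrite in_Iitv normr1 lerDl ltW. Qed.

Lemma IdeltaN x : (- x \in Iitv delta) = (x \in Iitv delta).
Proof. by rewrite !in_Iitv normrN. Qed.

Lemma Cr1_CrI r (f : Idelta delta -> R) : Cr1 r f <-> CrI delta r (ext f).
Proof. by apply: iff_sym; exact: CrIP. Qed.

Section Mdelta_theory.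
Variables (r : nat) (psi : Idelta delta -> R).
Hypotheses (r_ge1 : (1 <= r)%N) (Mpsi : Mdelta delta r psi).

Lemma Mdelta_into x : I x -> ext psi x \in Iitv delta.
Proof. by move=> Ix; rewrite (ext_in _ Ix); case: Mpsi. Qed.

Lemma Mdelta_CrI : CrI delta r (ext psi).
Proof. by apply/Cr1_CrI; case: Mpsi. Qed.

Lemma Mdelta_has_derivI x : I x ->
  has_derivI delta (ext psi) x (derivI delta (ext psi) x).
Proof.
move=> Ix; have [_ /(_ 0 isT)[_ dpsi] _ _ _] := Mpsi.
exact: dpsi.
Qed.

Lemma Mdelta_norm x : I x -> ext psi x = ext psi `|x|.
Proof.
by move=> Ix; have [_ _ ev _ _] := Mpsi; case: ger0P => // _; rewrite ev.
Qed.

(** Evenness extends to the whole interval the monotonicity that the sign of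
    the derivative gives on its positive half. *)
Lemma Mdelta_nonincreasing x y : I x -> I y -> `|x| <= `|y| ->
  ext psi y <= ext psi x.
Proof.
move=> Ix Iy xy; rewrite (Mdelta_norm Ix) (Mdelta_norm Iy).
have y1 : `|y| <= 1 + delta by rewrite -in_Iitv.
apply: (nonincreasing_derivI delta_gt0 (CrI_cont Mdelta_CrI)
  Mdelta_has_derivI) y1 => // z Iz z0.
have [_ _ _ _ /(_ z Iz)] := Mpsi.
by rewrite gt_eqF// => /(_ isT); rewrite pmulr_rlt0// => /ltW.
Qed.

Lemma Mdelta_le1 x : I x -> ext psi x <= 1.
Proof.
move=> Ix; have [_ _ _ <- _] := Mpsi.
apply: Mdelta_nonincreasing => //; first exact: Idelta0.
by rewrite normr0.
Qed.

End Mdelta_theory.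

Section DRdelta_theory.
Variables (r : nat) (psi : Idelta delta -> R).
Hypotheses (r_ge1 : (1 <= r)%N) (Dpsi : DRdelta delta r psi).

Let Mpsi : Mdelta delta r psi := proj1 Dpsi.
Let a := ext psi 1.
Let a' := (1 + delta) * a.
Let b' := ext psi a'.

Lemma DRdelta_a_lt0 : a < 0.
Proof. by case: Dpsi => _ []. Qed.

Lemma DRdelta_a'_gtN1 : -1 < a'.
Proof.
case: Dpsi => _ [a0 h1 h2 _]; rewrite ltrNl.
exact: lt_trans h1 h2.
Qed.

Lemma DRdelta_norm_scale x : I x -> `|a * x| <= - a'.
Proof.
rewrite /= in_Iitv => x1; rewrite normrM ltr0_norm ?DRdelta_a_lt0//.
by rewrite /a' -mulrN mulrC ler_wpM2r// oppr_ge0 ltW// DRdelta_a_lt0.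
Qed.

Lemma DRdelta_a'_lt0 : a' < 0.
Proof.
by rewrite /a' pmulr_rlt0 ?DRdelta_a_lt0//; apply: addr_gt0.
Qed.

(** The conditions [- a' < b' < 1] force [-1 < a']: the evaluation of [psi] at
    [a'] that defines [b'] takes place inside the interval. *)
Lemma DRdelta_a'_in : I a'.
Proof.
rewrite /= in_Iitv ltr0_norm ?DRdelta_a'_lt0//; apply: ltW.
rewrite ltrNl; apply: lt_trans DRdelta_a'_gtN1.
by rewrite opprD gtrDl oppr_lt0.
Qed.

Lemma DRdelta_scale_in x : I x -> I (a * x).
Proof.
move=> Ix; rewrite /= in_Iitv; apply: le_trans (DRdelta_norm_scale Ix) _.
by have := DRdelta_a'_in; rewrite /= in_Iitv ltr0_norm// DRdelta_a'_lt0.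
Qed.

Lemma DRdelta_image x : I x -> b' <= ext psi (a * x) <= 1.
Proof.
move=> Ix; have Iax := DRdelta_scale_in Ix.
rewrite (Mdelta_le1 r_ge1 Mpsi)// andbT.
apply: (Mdelta_nonincreasing r_ge1 Mpsi) => //; first exact: DRdelta_a'_in.
by rewrite (ltr0_norm DRdelta_a'_lt0) DRdelta_norm_scale.
Qed.

Lemma DRdelta_b'_gt0 : 0 < b'.
Proof.
case: Dpsi => _ [_ h _ _]; apply: lt_trans h.
by rewrite oppr_gt0 DRdelta_a'_lt0.
Qed.

Lemma DRdelta_image_in x : I x -> I (ext psi (a * x)).
Proof. by move=> Ix; apply: (Mdelta_into Mpsi); exact: DRdelta_scale_in. Qed.

(** As [psi (a * x)] is positive, [psi] is evaluated on its nonincreasing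
    side, at a point between [b'] and [1]. *)
Lemma DRdelta_image2 x : I x -> a <= ext psi (ext psi (a * x)) <= - a'.
Proof.
move=> Ix; have /andP[y0 y1] := DRdelta_image Ix.
have Iy := DRdelta_image_in Ix; have b0 := DRdelta_b'_gt0.
have y_gt0 := lt_le_trans b0 y0.
have Ib : I b' by apply: (Mdelta_into Mpsi); exact: DRdelta_a'_in.
apply/andP; split.
  apply: (Mdelta_nonincreasing r_ge1 Mpsi) => //; first exact: Idelta1.
  by rewrite normr1 gtr0_norm.
have [_ [_ _ _ /ltW]] := Dpsi; apply: le_trans.
by apply: (Mdelta_nonincreasing r_ge1 Mpsi) => //; rewrite !gtr0_norm.
Qed.

Lemma ext_Rdelta x : I x ->
  ext (Rdelta delta psi) x = a^-1 * ext psi (ext psi (a * x)).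
Proof. by move=> Ix; rewrite (ext_in _ Ix). Qed.

Lemma Rdelta_into : into1 (Rdelta delta psi).
Proof.
move=> [x Ix]; have /andP[l u] := DRdelta_image2 Ix.
have a0 := DRdelta_a_lt0; have na : 0 < - a by rewrite oppr_gt0.
rewrite /Rdelta /= -/a in_Iitv normrM normfV (ltr0_norm a0).
rewrite ler_pdivrMl// ler_norml mulrDr mulr1; move: l u; rewrite /a'.
(* The upper bound is exactly [- a' = (1 + delta) * (- a)]; the lower bound
   [a] has room to spare. *)
move=> l u; apply/andP; split; last by apply: le_trans u _; lra.
by apply: le_trans l; have := mulr_gt0 delta_gt0 na; lra.
Qed.

(** The factor [a] produced by the inner scaling cancels the outer division
    by [a]. *)
Lemma Rdelta_has_derivI x : I x ->
  has_derivI delta (ext (Rdelta delta psi)) x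
    (derivI delta (ext psi) (ext psi (a * x)) * derivI delta (ext psi) (a * x)).
Proof.
move=> Ix; have a0 := DRdelta_a_lt0.
have cpsi := CrI_cont (Mdelta_CrI Mpsi).
have ca : contI delta (fun y => a * y).
  exact: CrIM (CrI_cst _ 0 a) (CrI_id _ 0).
have cpa : contI delta (ext psi \o (fun y => a * y)).
  by apply: (@CrI_comp _ _ 0) => //; exact: DRdelta_scale_in.
have da : has_derivI delta (fun y => a * y) x (a * 1 + 0 * x).
  apply: has_derivIM => //; first exact: (CrI_cst delta 0 a).
    exact: has_derivI_cst.
  exact: has_derivI_id.
have dpa := has_derivI_comp Ix ca DRdelta_scale_in
  (Mdelta_has_derivI r_ge1 Mpsi (DRdelta_scale_in Ix)) da.
have dppa := has_derivI_comp Ix cpa DRdelta_image_in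
  (Mdelta_has_derivI r_ge1 Mpsi (DRdelta_image_in Ix)) dpa.
have := has_derivIM Ix (CrI_cst delta 0 a^-1)
  (has_derivI_cst delta a^-1 x) dppa.
rewrite mul0r addr0 mul0r addr0 mulr1 mulrCA [_ * a]mulrC mulKf ?lt_eqF//.
apply: eq_has_derivI => // y Iy.
by rewrite ext_Rdelta.
Qed.

Lemma Rdelta_CrI : CrI delta r (ext (Rdelta delta psi)).
Proof.
have sa : CrI delta r (fun x => a * x).
  exact: CrIM (CrI_cst _ _ a) (CrI_id _ _).
have sp := Mdelta_CrI Mpsi.
have s1 : CrI delta r (ext psi \o (fun x => a * x)).
  by apply: CrI_comp => //; exact: DRdelta_scale_in.
have s2 : CrI delta r (ext psi \o (ext psi \o (fun x => a * x))).
  by apply: CrI_comp => //; exact: DRdelta_image_in.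
apply: eq_CrI (CrIM (CrI_cst delta r a^-1) s2).
by move=> x Ix; rewrite ext_Rdelta.
Qed.

Lemma Rdelta_Mdelta : Mdelta delta r (Rdelta delta psi).
Proof.
have a0 := DRdelta_a_lt0.
have [_ _ ev p0 np] := Mpsi; split.
- exact: Rdelta_into.
- by apply/Cr1_CrI; exact: Rdelta_CrI.
- move=> x Ix; rewrite !ext_Rdelta ?IdeltaN//=; last by rewrite IdeltaN.
  by rewrite mulrN ev// DRdelta_scale_in.
- rewrite ext_Rdelta; last exact: Idelta0.
  by rewrite mulr0 p0 -/a mulVf ?lt_eqF.
- move=> x Ix x0; rewrite (has_derivIE delta_gt0 Ix (Rdelta_has_derivI Ix)).
  have /andP[y0 _] := DRdelta_image Ix.
  have y_gt0 := lt_le_trans DRdelta_b'_gt0 y0.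
  have := np _ (DRdelta_image_in Ix); rewrite gt_eqF// => /(_ isT).
  rewrite pmulr_rlt0// => d1.
  have := np _ (DRdelta_scale_in Ix).
  rewrite mulf_eq0 negb_or x0 andbT lt_eqF// => /(_ isT).
  rewrite -mulrA nmulr_rlt0// => d2.
  by rewrite mulrCA nmulr_rlt0.
Qed.

End DRdelta_theory.
End OneDim.

(** * Functions that do not depend on theta *)

Section ThetaIndependent.
Variables (R : realType) (delta : R).
Hypothesis delta_gt0 : 0 < delta.
Local Notation I := [set` Iitv delta].
Implicit Types (w : seq bool) (g : R -> R) (psi : Idelta delta -> R).

(** What a word of differentiations does to a function of [x] alone: the
    derivative in theta annihilates it. *)
Definition word_derivI w g : R -> R :=
  foldr (fun b h => if b then cst 0 else derivI delta h) g w.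

Lemma mixed_theta_indep w g : mixed delta w (fun=> g) = fun=> word_derivI w g.
Proof.
elim: w => //= b w ->; apply/funext => t; apply/funext => x.
by case: b => //; rewrite /dtheta derive1_cst.
Qed.

Lemma word_derivI_x w g : true \notin w ->
  word_derivI w g = iter (size w) (derivI delta) g.
Proof. by elim: w => //= -[|] w IH //; rewrite inE /= => /IH ->. Qed.

(** Only on the interval: outside of it, [derivI] of the null function is a
    limit along a filter that need not be proper, hence a junk value. *)
Lemma word_derivI_theta w g : true \in w ->
  {in Iitv delta, cst 0 =1 word_derivI w g}.
Proof.
elim: w => //= -[|] w IH // /IH w0 x Ix.
by rewrite -(eq_derivI w0 Ix) (derivI_cst delta_gt0 0 Ix).
Qed.

Lemma contI_snd g : contI delta g ->
  {within [set: R] `*` I, continuous (fun p : R * R => g p.2)}.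
Proof.
move=> cg; apply/subspace_continuousP => -[t x] [_ /= Ix].
suff c2 : snd @ within ([set: R] `*` I) (nbhs (t, x)) --> within I (nbhs x).
  exact: cvg_comp c2 (cg x Ix).
move=> A.
change (nbhs x [set y | I y -> A y] ->
  nbhs (t, x) [set p : R * R | ([set: R] `*` I) p -> A p.2]).
move=> Ax.
have : nbhs (t, x) [set p : R * R | I p.2 -> A p.2].
  exact: (@cvg_snd _ _ (nbhs t) (nbhs x) _ _ Ax).
by apply: filterS => -[s y] /= Ay [_]; exact: Ay.
Qed.

Lemma lift_theta_incl psi : Defs.lift (theta_incl delta psi) = fun=> ext psi.
Proof. by []. Qed.

Lemma Cr2_theta_incl r psi : Cr1 r psi -> Cr2 r (theta_incl delta psi).
Proof.
move=> /Cr1_CrI-/(_ delta_gt0)/CrIP-/(_ delta_gt0) Cpsi w wr.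
rewrite lift_theta_incl mixed_theta_indep.
have [cw dw] : contI delta (word_derivI w (ext psi)) /\ ((size w < r)%N ->
    forall x, I x -> derivableI delta (word_derivI w (ext psi)) x).
  have [tw|tw] := boolP (true \in w).
    have w0 := word_derivI_theta (ext psi) tw.
    split; first exact: eq_contI w0 (CrI_cst delta 0 0).
    move=> _ x Ix; apply: (cvgP 0).
    exact: (eq_has_derivI Ix w0 (has_derivI_cst _ _ _)).
  have [cw dw] := Cpsi _ wr; rewrite word_derivI_x//; split => //.
  exact/subspace_continuousP.
split; first exact: contI_snd.
move=> wr' t x Ix; split; last exact: dw.
exact: derivable_cst.
Qed.

(** Words containing theta contribute 0 to the supremum, and the other words
    contribute exactly the one-variable derivatives. *)
Lemma Cr_norm2_theta_incl r psi :
  Cr_norm2 r (theta_incl delta psi) = Cr_norm1 r psi.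
Proof.
apply/eqP; rewrite eq_le; apply/andP; split; last first.
  apply: ereal_sup_le => _ [k [x [kr Ix ->]]].
  (* Differentiate [k] times in [x] only. *)
  exists (nseq k false), 0, x; rewrite size_nseq; split => //.
  rewrite lift_theta_incl mixed_theta_indep word_derivI_x ?size_nseq//.
  by rewrite mem_nseq andbF.
apply: ge_ereal_sup => _ [w [t [x [wr Ix ->]]]].
rewrite lift_theta_incl mixed_theta_indep.
have [tw|tw] := boolP (true \in w); last first.
  rewrite word_derivI_x//; apply: ereal_sup_ubound.
  by exists (size w), x.
rewrite -(word_derivI_theta _ tw Ix) normr0.
(* The mixed derivative is 0, below the norm of any value of [psi]. *)
apply: le_trans (ereal_sup_ubound _); last first.
  by exists 0, x.
by rewrite lee_fin.
Qed.

Lemma Rintegral01_cst (c : R) :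
  (\int[@lebesgue_measure R]_(t in `[0%R, 1%R]) c)%R = c.
Proof.
rewrite Rintegral_cst//= lebesgue_measure_itv/= lte01 sube0 /=.
by rewrite mulr1.
Qed.

Lemma p0_theta_incl psi : p0 (theta_incl delta psi) = psi.
Proof. by apply/funext => x; exact: Rintegral01_cst. Qed.

Lemma ahat_theta_incl psi : ahat (theta_incl delta psi) = ext psi 1.
Proof. exact: (Rintegral01_cst (ext psi 1)). Qed.

Lemma Tomega_theta_incl omega psi :
  Tomega delta omega (theta_incl delta psi)
  = theta_incl delta (Rdelta delta psi).
Proof.
apply/funext => t; apply/funext => x.
by rewrite /Tomega ahat_theta_incl.
Qed.

Lemma theta_incl_inj : injective (theta_incl delta).
Proof. by move=> phi psi /(congr1 (fun f => f 0)). Qed.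

Lemma theta_incl_bij r :
  set_bij (Mdelta delta r) (Xspace0 delta r) (theta_incl delta).
Proof.
split.
- move=> psi Mpsi; split; last by rewrite p0_theta_incl.
  have [psi_into psiC _ _ _] := Mpsi.
  by split; rewrite ?p0_theta_incl//; exact: Cr2_theta_incl.
- by move=> phi psi _ _; exact: theta_incl_inj.
- by move=> f [[_ _ Mf] f0]; exists (p0 f).
Qed.

Lemma DT0_DT r omega : (1 <= r)%N -> DT0 delta r `<=` DT delta r omega.
Proof.
move=> r1 _ [psi Dpsi <-]; have [iX _ _] := theta_incl_bij r.
split; rewrite ?ahat_theta_incl ?Tomega_theta_incl.
- by have [] := iX _ (proj1 Dpsi).
- by rewrite lt_eqF//; exact: DRdelta_a_lt0 Dpsi.
- by move=> x; exact: (DRdelta_scale_in delta_gt0 Dpsi).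
- by have [] := iX _ (Rdelta_Mdelta delta_gt0 r1 Dpsi).
Qed.

End ThetaIndependent.

Theorem proposition2p11 (R : realType) (delta : R) (r : nat) (omega : torus R)
    (delta_gt0 : 0 < delta) (r_ge1 : (1 <= r)%N) :
  [/\ (DT0 delta r `<=` DT delta r omega)%classic,
      Cr_isomorphism r (Mdelta delta r) (Xspace0 delta r) (theta_incl delta),
      conjugates (DRdelta delta r) (Mdelta delta r)
        (DT0 delta r) (Xspace0 delta r)
        (theta_incl delta) (Rdelta delta) (Tomega delta omega) &
      forall psi : Idelta delta -> R,
        DRdelta delta r psi -> Rdelta delta psi = psi ->
        DT delta r omega (theta_incl delta psi) /\
        Tomega delta omega (theta_incl delta psi) = theta_incl delta psi].
Proof.
have hDT := DT0_DT delta_gt0 omega r_ge1.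
have hbij := theta_incl_bij delta_gt0 r; have [iX _ _] := hbij.
have RM psi : DRdelta delta r psi -> Mdelta delta r (Rdelta delta psi).
  exact: Rdelta_Mdelta.
split=> //.
- split=> // phi psi _ _.
  exact: (Cr_norm2_theta_incl delta_gt0 r (fun x => phi x - psi x)).
- split=> //; last by move=> psi _; exact: Tomega_theta_incl.
    split; first by move=> psi Dpsi; exists psi.
      by move=> phi psi _ _; exact: theta_incl_inj.
    by move=> _ [psi Dpsi <-]; exists psi.
  by move=> _ [psi /RM Mpsi <-]; rewrite Tomega_theta_incl; exact: iX.
- move=> psi Dpsi fpsi; rewrite Tomega_theta_incl fpsi; split=> //.
  by apply: hDT; exists psi.
Qed.
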